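(* Let $L:\mathbb{T}^d\times\mathbb{R}^d\to\mathbb{R}$ be a continuous function such that $q\mapsto L(x,q)$ is convex on $\mathbb{R}^d$ for every $x$, and $\inf_{x} L(x,q)/|q|\to+\infty$ as $|q|\to+\infty$. Let $\tau>0$. Then there exists a unique constant $\alpha_\tau\in\mathbb{R}$ for which the equation $$\mathcal{L}_\tau u = u-\tau\alpha_\tau \qquad\text{in } \mathbb{T}^d$$ admits a solution $u\in C(\mathbb{T}^d)$. Furthermore, solutions $u\in C(\mathbb{T}^d)$ of this equation are unique up to additive constants.
   Context: $\mathbb{T}^d=\mathbb{R}^d/\mathbb{Z}^d$ is the flat torus; functions on $\mathbb{T}^d$ are identified with $\mathbb{Z}^d$-periodic functions on $\mathbb{R}^d$ (so $L$ is $\mathbb{Z}^d$-periodic in $x$). $C(\mathbb{T}^d)$ is the space of continuous $\mathbb{Z}^d$-periodic functions on $\mathbb{R}^d$ with the sup norm. For $\tau>0$ the heat kernel is $\eta^\tau(y)=(4\pi\tau)^{-d/2}e^{-|y|^2/(4\tau)}$ and $(\eta^\tau*u)(y)=\int_{\mathbb{R}^d}\eta^\tau(y-z)u(z)\,dz$. The operator $\mathcal{L}_\tau:C(\mathbb{T}^d)\to C(\mathbb{T}^d)$ is $$\mathcal{L}_\tau u(x)=\min_{q\in\mathbb{R}^d}\big(\tau L(x,-q)+(\eta^\tau*u)(x+\tau q)\big),\qquad x\in\mathbb{R}^d.$$ *)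

(* Defs.v *)
From HB Require Import structures.
From mathcomp Require Import all_boot all_order all_algebra.
From mathcomp Require Import all_classical all_reals all_analysis.

Set Implicit Arguments.
Unset Strict Implicit.
Unset Printing Implicit Defensive.

Import Order.TTheory GRing.Theory Num.Theory.
Import numFieldNormedType.Exports.

Local Open Scope classical_set_scope.
Local Open Scope ring_scope.

Section LebesgueTuple.
Context {R : realType}.

Definition cons_pair (n : nat)
    (p : measurableTypeR R * n.-tuple (measurableTypeR R)) :
  n.+1.-tuple (measurableTypeR R) := [tuple of p.1 :: p.2].

Lemma measurable_cons_pair (n : nat) : measurable_fun setT (@cons_pair n).
Proof.
by apply: measurable_cons; [exact: measurable_fst|exact: measurable_snd].
Qed.

Section Succ.
Variables (n : nat)
  (mu : {measure set (n.-tuple (measurableTypeR R)) -> \bar R}).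

(* [\x^] rather than [\x]: it only requires its left factor to be sigma-finite,
   so the recursion below need not carry sigma-finiteness. *)
Definition lebesgue_cons : set (n.+1.-tuple (measurableTypeR R)) -> \bar R :=
  pushforward (lebesgue_measure \x^ mu)%E (@cons_pair n).

Let mcons := @measurable_cons_pair n.

Let lebesgue_cons0 : lebesgue_cons set0 = 0%E.
Proof. by rewrite /lebesgue_cons /pushforward preimage_set0 measure0. Qed.

Let lebesgue_cons_ge0 A : (0 <= lebesgue_cons A)%E.
Proof. exact: measure_ge0. Qed.

Let lebesgue_cons_sigma_additive : semi_sigma_additive lebesgue_cons.
Proof. exact: measure_semi_sigma_additive. Qed.

HB.instance Definition _ := isMeasure.Build _ _ _ lebesgue_cons
  lebesgue_cons0 lebesgue_cons_ge0 lebesgue_cons_sigma_additive.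

End Succ.

(* Lebesgue measure on R^n, carried by n-tuples because the library provides the
   product sigma-algebra on tuples but none on row vectors; it is characterized
   by [lebesgue_tuple_box]. *)
Fixpoint lebesgue_tuple (n : nat) :
    {measure set (n.-tuple (measurableTypeR R)) -> \bar R} :=
  if n is m.+1 then lebesgue_cons (lebesgue_tuple m)
  else \d_([tuple] : 0.-tuple (measurableTypeR R)).

Lemma lebesgue_tuple_box (n : nat) (A : 'I_n -> set (measurableTypeR R)) :
  (forall i, measurable (A i)) ->
  lebesgue_tuple n [set x | forall i, A i (tnth x i)] =
  (\big[mule/1]_(i < n) lebesgue_measure (A i))%E.
Proof.
elim: n A => [|n IHn] A mA.
  by rewrite big_ord0 /= diracE mem_set//= => -[].
rewrite big_ord_recl -(IHn (fun i => A (lift ord0 i)))//=.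
rewrite /lebesgue_cons /pushforward.
have -> : @cons_pair n @^-1` [set x | forall i, A i (tnth x i)] =
    A ord0 `*` [set x | forall i, A (lift ord0 i) (tnth x i)].
  apply/seteqP; split=> -[a t] /=.
    move=> At; split; first exact: (At ord0).
    by move=> i; have := At (lift ord0 i); rewrite /cons_pair/= tnthS.
  move=> [A0 At] i; have [j ->|-> //] := unliftP ord0 i.
  by rewrite /cons_pair/= tnthS.
rewrite product_measure2E//.
have -> : [set x | forall i, A (lift ord0 i) (tnth x i)] =
    \bigcap_(i in [set: 'I_n])
      ((fun x : n.-tuple (measurableTypeR R) => tnth x i) @^-1`
        A (lift ord0 i)).
  by apply/seteqP; split=> [x /= h i _|x /= h i]; [exact: h|exact: h].
apply: fin_bigcap_measurable => // i _; rewrite -[X in measurable X]setTI.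
exact: measurable_tnth.
Qed.

End LebesgueTuple.

Section Torus.
Context {R : realType} {d : nat}.
Implicit Types (x y q : 'rV[R]_d) (u v : 'rV[R]_d -> R) (tau : R).

(* The library norm on row vectors is the sup norm. *)
Definition enorm x : R := Num.sqrt (\sum_i x ord0 i ^+ 2).

Definition Zperiodic u :=
  forall x (k : 'rV[int]_d), u (x + map_mx intr k) = u x.

Definition C_torus : set ('rV[R]_d -> R) :=
  [set u | continuous u /\ Zperiodic u].

Definition row_of_tuple (z : d.-tuple (measurableTypeR R)) : 'rV[R]_d :=
  \row_i tnth z i.

Definition heat_kernel tau y : R :=
  (4 * pi * tau) `^ (- (d%:R / 2)) * expR (- (enorm y ^+ 2 / (4 * tau))).

Definition heat_conv tau u y : R :=
  \int[lebesgue_tuple d]_z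
    (heat_kernel tau (y - row_of_tuple z) * u (row_of_tuple z)).

(* |q| ranges over large values, so the division is never by 0; the infimum is
   taken in \bar R because in R it has a junk value on unbounded sets. *)
Definition superlinear (L : 'rV[R]_d -> 'rV[R]_d -> R) :=
  forall M : R, exists K : R, 0 <= K /\ forall q, K < enorm q ->
    (M%:E <= ereal_inf [set (L x q / enorm q)%:E | x in [set: 'rV[R]_d]])%E.

Definition is_minimum (S : set R) (m : R) := S m /\ lbound S m.

(* The graph of the operator: [lax_oleinik L tau u v] states that v is the image
   of u; in particular, that the minimum over q is attained at every x. *)
Definition lax_oleinik (L : 'rV[R]_d -> 'rV[R]_d -> R) tau u v :=
  forall x, is_minimum
    [set tau * L x (- q) + heat_conv tau u (x + tau *: q) | q in [set: 'rV[R]_d]]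
    (v x).

Definition cell_solution (L : 'rV[R]_d -> 'rV[R]_d -> R) tau (alpha : R) u :=
  C_torus u /\ lax_oleinik L tau u (fun x => u x - tau * alpha).

End Torus.

(* Main.v *)
Require Import Defs.
From HB Require Import structures.
From mathcomp Require Import all_boot all_order all_algebra.
From mathcomp Require Import all_classical all_reals all_analysis.
From mathcomp Require Import measurable_realfun ring lra.
Import Order.TTheory GRing.Theory Num.Theory.
Import numFieldNormedType.Exports.
Local Open Scope classical_set_scope.
Local Open Scope ring_scope.

(** Write [osc f = sup f - inf f]. The operator is the heat semigroup followed
    by a minimization over [q]. The minimization is monotone and commutes with
    constants, so [osc (v1 - v2) <= osc (w1 - w2)] between its outputs and
    inputs. The heat kernel is bounded below by some [c > 0] on the unit cube
    (Doeblin's condition), so convolution with it contracts [osc] by [1 - c].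
    Hence the operator is a strict contraction of continuous functions modulo
    constants: Banach's iteration yields a solution, and two solutions differ
    by a constant, which forces the same [alpha]. *)

Set Implicit Arguments.
Unset Strict Implicit.
Unset Printing Implicit Defensive.

(** * Lebesgue measure on tuples *)

(** Needed for Tonelli's theorem; the cubes [[-k, k]^n] have finite measure and exhaust the
    space. *)
Lemma sigma_finite_lebesgue_tuple (R : realType) (n : nat) :
  sigma_finite setT (@lebesgue_tuple R n).
Proof.
pose I k : set (measurableTypeR R) := `[- k%:R, k%:R]%classic.
exists (fun k : nat => [set x : n.-tuple (measurableTypeR R) |
   forall i, I k (tnth x i)]).
  apply/seteqP; split => // x _.
  pose M := \big[Num.max/0]_(i < n) `|tnth x i : R|.
  exists (Num.truncn M).+1 => // i; rewrite /I /= in_itv /= -ler_norml.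
  apply: (@le_trans _ _ M); first exact: (le_bigmax _ (fun j => `|tnth x j : R|)).
  exact/ltW/truncnS_gt.
move=> k; have mI : measurable (I k) by exact: measurable_itv.
split; last first.
  rewrite (lebesgue_tuple_box (A := fun=> I k))//.
  rewrite -ge0_fin_numE; last by apply: prode_ge0 => i _; exact: measure_ge0.
  apply: prode_fin_num => i _.
  by rewrite /I lebesgue_measure_itv /=; case: ifP.
rewrite /=.
have -> : [set x : n.-tuple (measurableTypeR R) | forall i, I k (tnth x i)] =
    \bigcap_(i in [set: 'I_n])
      ((fun x : n.-tuple (measurableTypeR R) => tnth x i) @^-1` I k).
  by apply/seteqP; split=> [x /= h i _|x /= h i]; [exact: h|exact: h].
apply: fin_bigcap_measurable => // i _; rewrite -[X in measurable X]setTI.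
exact: measurable_tnth.
Qed.

(* A constant to which canonical structures can attach: [lebesgue_tuple n] is
   itself a bundled measure. *)
Definition lebesgue_tuple_fun (R : realType) (n : nat) :
  set (n.-tuple (measurableTypeR R)) -> \bar R := lebesgue_tuple n.

HB.instance Definition _ (R : realType) (n : nat) :=
  Measure.copy (@lebesgue_tuple_fun R n) (lebesgue_tuple n).

HB.instance Definition _ (R : realType) (n : nat) :=
  Measure_isSigmaFinite.Build _ _ _ (@lebesgue_tuple_fun R n)
    (@sigma_finite_lebesgue_tuple R n).

(** [lebesgue_cons] is built on [\x^], while Tonelli's theorem is applied to [\x]; the two products
    agree on rectangles, hence everywhere by uniqueness of the product measure. *)
Lemma ge0_integral_lebesgue_tupleS (R : realType) (n : nat)
    (f : n.+1.-tuple (measurableTypeR R) -> \bar R) :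
  measurable_fun [set: n.+1.-tuple (measurableTypeR R)] f -> (forall x, 0 <= f x)%E ->
  (\int[lebesgue_tuple n.+1]_x f x =
   \int[lebesgue_measure]_a \int[lebesgue_tuple n]_t f [tuple of a :: t])%E.
Proof.
move=> mf f0.
pose mu : {sigma_finite_measure set _ -> \bar R} := @lebesgue_tuple_fun R n.
transitivity (\int[lebesgue_measure \x^ mu]_p (f \o @cons_pair R n) p)%E.
  rewrite /= /lebesgue_cons ge0_integral_pushforward//.
  exact: measurable_cons_pair.
have mfc : measurable_fun setT (f \o @cons_pair R n).
  by apply: measurableT_comp => //; exact: measurable_cons_pair.
transitivity (\int[lebesgue_measure \x mu]_p (f \o @cons_pair R n) p)%E.
  apply: eq_measure_integral => //= A mA _; apply/esym.
  by apply: product_measure_unique => // B C mB mC/=; rewrite product_measure2E.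
by rewrite fubini_tonelli1 //= => x; exact: f0.
Qed.

(** Translation preserves the length of half-open intervals, and these determine Lebesgue
    measure. *)
Lemma ge0_integral_lebesgueD (R : realType) (h : R)
    (f : measurableTypeR R -> \bar R) :
  measurable_fun [set: _] f -> (forall x, 0 <= f x)%E ->
  (\int[lebesgue_measure]_x f (x + h)%R = \int[lebesgue_measure]_x f x)%E.
Proof.
move=> mf f0.
pose s (x : measurableTypeR R) : measurableTypeR R := x + h.
have ms : measurable_fun setT s by exact: measurable_funD.
have -> : (\int[lebesgue_measure]_x f x =
    \int[pushforward lebesgue_measure s]_x f x)%E.
  apply: eq_measure_integral => //= A mA _.
  apply: lebesgue_measure_unique => //= _ [[a b]] _ <-.
  rewrite /pushforward /=.
  have -> : s @^-1` `]a, b] = `]a - h, b - h]%classic.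
    by apply/seteqP; split => x /=; rewrite !in_itv/= ltrBlDr lerBrDr.
  rewrite !lebesgue_measure_itv/= !lte_fin ltrBlDr subrK.
  by case: ifP => // _; rewrite -!EFinD opprB addrA subrK.
by rewrite ge0_integral_pushforward.
Qed.

Definition shift_tuple (R : realType) (n : nat) (h : 'I_n -> R)
    (t : n.-tuple (measurableTypeR R)) : n.-tuple (measurableTypeR R) :=
  [tuple tnth t i + h i | i < n].

Lemma measurable_shift_tuple (R : realType) (n : nat) (h : 'I_n -> R) :
  measurable_fun setT (@shift_tuple R n h).
Proof.
apply/measurable_fun_tnthP => i.
rewrite (_ : _ \o _ = fun t => tnth t i + h i); last first.
  by apply/funext => t; rewrite /= /shift_tuple tnth_mktuple.
by apply: measurable_funD => //; exact: measurable_tnth.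
Qed.

Lemma shift_tuple_cons (R : realType) (n : nat) (h : 'I_n.+1 -> R) (a : R)
    (t : n.-tuple (measurableTypeR R)) :
  shift_tuple h [tuple of a :: t] =
  [tuple of (a + h ord0) :: shift_tuple (h \o lift ord0) t].
Proof.
apply: eq_from_tnth => i; rewrite tnth_mktuple.
by have [j ->|->] := unliftP ord0 i; rewrite ?tnthS ?tnth0// tnth_mktuple.
Qed.

(** Tonelli splits off the first coordinate; the induction hypothesis shifts the tail, and
    translation invariance on the line shifts the head. *)
Lemma ge0_integral_shift_tuple (R : realType) (n : nat) (h : 'I_n -> R)
    (f : n.-tuple (measurableTypeR R) -> \bar R) :
  measurable_fun [set: n.-tuple (measurableTypeR R)] f -> (forall x, 0 <= f x)%E ->
  (\int[lebesgue_tuple n]_x f (shift_tuple h x) = \int[lebesgue_tuple n]_x f x)%E.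
Proof.
elim: n h f => [|n IH] h f mf f0.
  by apply: eq_integral => x _; congr f; apply: eq_from_tnth => -[].
have mfh : measurable_fun setT (f \o shift_tuple h).
  by apply: measurableT_comp => //; exact: measurable_shift_tuple.
have mc a : measurable_fun setT
    (fun t : n.-tuple (measurableTypeR R) => f [tuple of a :: t]).
  by apply: (measurableT_comp mf); apply: measurable_cons.
rewrite ge0_integral_lebesgue_tupleS// ge0_integral_lebesgue_tupleS//.
under eq_integral do under eq_integral do rewrite shift_tuple_cons.
under eq_integral => a _.
  rewrite (IH _ (fun t => f [tuple of a + h ord0 :: t]))//.
  over.
rewrite (@ge0_integral_lebesgueD _ _
  (fun a => \int[lebesgue_tuple n]_t f [tuple of a :: t])%E) //.
- pose mu : {sigma_finite_measure set _ -> \bar R} := @lebesgue_tuple_fun R n.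
  apply: (measurable_fun_fubini_tonelli_F (m2 := mu) (f \o @cons_pair R n)) => //.
  by apply: measurableT_comp => //; exact: measurable_cons_pair.
  by move=> p; exact: f0.
- by move=> a; exact: integral_ge0.
Qed.

(** Tuples carry the product sigma-algebra. A ball of the sup norm is a box, hence measurable, and
    an open set is a countable union of balls with rational centre and radius. *)
Lemma measurable_preimage_row_of_tuple (R : realType) (d : nat)
    (U : set 'rV[R]_d) :
  open U -> measurable (@row_of_tuple R d @^-1` U).
Proof.
move=> oU.
pose B (p : 'rV[rat]_d * rat) := ball (map_mx ratr p.1 : 'rV[R]_d) (ratr p.2 : R).
have -> : @row_of_tuple R d @^-1` U =
    \bigcup_p (if `[< B p `<=` U >] then @row_of_tuple R d @^-1` B p else set0).
  apply/seteqP; split => t /=; last first.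
    by move=> [p _]; case: asboolP => // BU /BU.
  move=> Ut; have /nbhs_ballP[e /= e0 eU] : nbhs (row_of_tuple t) U.
    by apply: open_nbhs_nbhs; split.
  (* With [r < e / 2], a ball of radius [r] that contains the point stays within distance [e] of
     it. *)
  have [r] := rat_in_itvoo (divr_gt0 e0 (@ltr0Sn R 1)).
  rewrite in_itv /= => /andP[r0 re].
  have /all_sig[c cP] : forall i : 'I_d,
      {q : rat | ball (tnth t i) (ratr r : R) (ratr q)}.
    move=> i; apply: cid.
    have [|q] := @rat_in_itvoo R (tnth t i - ratr r) (tnth t i + ratr r).
      by rewrite ltrBlDr -addrA ltrDl addr_gt0.
    rewrite in_itv /= => /andP[q1 q2]; exists q.
    by rewrite /ball /= ltr_norml; apply/andP; split; lra.
  have Bt : B (\row_i c i, r) (row_of_tuple t).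
    split => // i j; rewrite !mxE; apply: ball_sym; exact: cP.
  exists (\row_i c i, r) => //; case: asboolP => // -[]; move=> x xB.
  apply: eU; apply: (@le_ball _ _ _ (ratr r + ratr r)); first by lra.
  by apply: ball_triangle xB; exact: ball_sym.
apply: countable_bigcupT_measurable => // -[c r].
case: asboolP => // _; have [r0|r0] := ltP 0 (ratr r : R); last first.
  rewrite (_ : _ @^-1` _ = set0) //; apply/seteqP; split => // t [/lt_le_trans].
  by move=> /(_ _ r0); rewrite ltxx.
have -> : @row_of_tuple R d @^-1` B (c, r) =
    \bigcap_(i in [set: 'I_d]) ((fun t : d.-tuple (measurableTypeR R) => tnth t i)
      @^-1` ball (ratr (c ord0 i) : R) (ratr r : R)).
  apply/seteqP; split => [t [_ tB] i _ /=|t tB /=].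
    by have := tB ord0 i; rewrite !mxE.
  by split => // i j; rewrite ord1 !mxE; exact: tB.
apply: fin_bigcap_measurable => // i _; rewrite -[X in measurable X]setTI.
by apply: (measurable_tnth i) => //; apply: measurable_ball.
Qed.

Lemma measurable_comp_row_of_tuple (R : realType) (d : nat) (f : 'rV[R]_d -> R) :
  continuous f ->
  measurable_fun [set: d.-tuple (measurableTypeR R)] (f \o @row_of_tuple R d).
Proof.
move=> /continuousP cf; apply: (measurability _ (RGenOpens.measurableE R)).
move=> _ [_ [a [b ->] <-]]; rewrite setTI comp_preimage.
by apply: measurable_preimage_row_of_tuple; apply: cf; exact: interval_open.
Qed.

(** * The heat kernel as a Gaussian density *)

(** Variance [2 * tau] in each coordinate. The factorization reduces measurability and total mass to
    one-dimensional Gaussian densities. *)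
Lemma heat_kernel_prod (R : realType) (d : nat) (tau : R) (y : 'rV[R]_d) z :
  0 < tau ->
  heat_kernel tau (y - row_of_tuple z) =
  \prod_(i < d) normal_pdf (y ord0 i) (Num.sqrt (2 * tau)) (tnth z i).
Proof.
move=> tau0.
have s0 : Num.sqrt (2 * tau) != 0 by rewrite sqrtr_eq0 -ltNge mulr_gt0.
under eq_bigr do
  rewrite normal_pdfE// /normal_peak /normal_fun sqr_sqrtr ?mulr_ge0 ?ltW//.
rewrite big_split/= -expR_sum /heat_kernel /enorm sqr_sqrtr; last first.
  by apply: sumr_ge0 => i _; exact: sqr_ge0.
congr (_ * expR _).
  rewrite prodr_const card_ord.
  have p0 : 0 < 4 * pi * tau by rewrite !mulr_gt0 ?pi_gt0.
  have -> : 2 * tau * pi *+ 2 = 4 * pi * tau by rewrite -mulr_natr; ring.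
  rewrite -powR12_sqrt ?ltW// -powRN -powR_mulrn ?powR_ge0// -powRrM; congr (_ `^ _).
  by field.
rewrite mulr_suml -sumrN; apply: eq_bigr => i _; rewrite !mxE -mulr_natr.
by field; rewrite gt_eqF.
Qed.

Lemma integral_heat_kernel (R : realType) (d : nat) (tau : R) (y : 'rV[R]_d) :
  0 < tau ->
  (\int[lebesgue_tuple d]_z (heat_kernel tau (y - row_of_tuple z))%:E = 1)%E.
Proof.
move=> tau0; under eq_integral do rewrite heat_kernel_prod//.
set s := Num.sqrt _.
have mp : forall m (c : 'I_m -> R), measurable_fun [set: m.-tuple (measurableTypeR R)]
    (fun z => (\prod_(i < m) normal_pdf (c i) s (tnth z i))).
  move=> m c; apply: measurable_prod => i _.
  apply: measurableT_comp; last exact: measurable_tnth.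
  exact: measurable_normal_pdf.
(* The centre is generalized to a function of the index, so that the induction hypothesis applies to
   its tail. *)
elim: {y}d (y ord0) => [|n IH] y.
  under eq_integral do rewrite big_ord0.
  by rewrite integral_cst// mul1e /= diracT.
rewrite ge0_integral_lebesgue_tupleS; first last.
- by move=> z; rewrite lee_fin prodr_ge0// => i _; exact: normal_pdf_ge0.
- by apply/measurable_EFinP; exact: mp.
rewrite -[RHS](integral_normal_pdf (y ord0) s); apply: eq_integral => a _.
under eq_integral.
  move=> t _; rewrite big_ord_recl tnth0 EFinM.
  under eq_bigr do rewrite tnthS.
  over.
rewrite ge0_integralZl//=.
- by rewrite (IH (fun i => y (lift ord0 i))) mule1.
- by apply/measurable_EFinP; exact: mp.
- by move=> t _; rewrite lee_fin prodr_ge0// => i _; exact: normal_pdf_ge0.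
- by rewrite lee_fin normal_pdf_ge0.
Qed.

(** * Periodic functions *)

Section TorusFunctions.
Context {R : realType} {d : nat}.
Implicit Types (x y h : 'rV[R]_d) (u v : 'rV[R]_d -> R).

(** Closed, hence compact, and it meets every orbit of the integer translations. *)
Definition unit_cube : set 'rV[R]_d :=
  [set x | forall i, `[0, 1]%classic (x ord0 i)].

Lemma compact_unit_cube : compact unit_cube.
Proof.
apply: (@rV_compact _ _ (fun=> `[(0 : R), 1]%classic)) => _.
exact: segment_compact.
Qed.

Lemma unit_cube_repr x : exists k : 'rV[int]_d, unit_cube (x + map_mx intr k).
Proof.
exists (\row_i - Num.floor (x ord0 i)) => i /=; rewrite !mxE in_itv /= mulrNz.
rewrite subr_ge0 floor_le lerBlDr addrC -[1 in leRHS]/(1%:~R) -intrD.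
by rewrite ltW// floorD1_gt.
Qed.

(** The increment [z] is there for uniform continuity, which compares [u] at two nearby points moved
    by the same integer vector. *)
Lemma Zperiodic_unit_cube u x :
  Zperiodic u -> exists2 y, unit_cube y & forall z, u (z + y) = u (z + x).
Proof.
move=> pu; have [k xk] := unit_cube_repr x; exists (x + map_mx intr k) => // z.
by rewrite addrA pu.
Qed.

Lemma C_torus_cst (c : R) : C_torus (fun _ : 'rV[R]_d => c).
Proof. by split => [|x k //]; exact: cst_continuous. Qed.

Lemma C_torusB u v : C_torus u -> C_torus v -> C_torus (fun x => u x - v x).
Proof.
move=> [cu pu] [cv pv]; split => [x|x k]; first exact: cvgB (cu x) (cv x).
by rewrite pu pv.
Qed.

Lemma C_torusD u v : C_torus u -> C_torus v -> C_torus (fun x => u x + v x).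
Proof.
move=> [cu pu] [cv pv]; split => [x|x k]; first exact: cvgD (cu x) (cv x).
by rewrite pu pv.
Qed.

Lemma C_torus_translate u h : C_torus u -> C_torus (fun x => u (x + h)).
Proof.
move=> [cu pu]; split => [x|x k]; last by rewrite addrAC pu.
apply: (@continuous_comp _ _ _ (fun x => x + h) u x); last exact: cu.
by apply: (@continuousD _ _ _ id (fun=> h)); [exact: cvg_id|exact: cst_continuous].
Qed.

Lemma C_torus_min u : C_torus u -> exists x, forall y, u x <= u y.
Proof.
move=> [cu pu].
have [||x _ ux] := compact_EVT_min (f := u) _ compact_unit_cube _.
- by exists 0 => i /=; rewrite mxE in_itv /= lexx ler01.
- exact: continuous_subspaceT.
- exists x => y; have [z /mem_set/ux zy /(_ 0)] := Zperiodic_unit_cube y pu.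
  by rewrite !add0r => <-.
Qed.

Lemma C_torus_max u : C_torus u -> exists x, forall y, u y <= u x.
Proof.
move=> /(C_torusB (C_torus_cst 0))/C_torus_min[x xP].
by exists x => y; have := xP y; rewrite !sub0r lerN2.
Qed.

Lemma C_torus_bounded u : C_torus u -> exists M, forall x, `|u x| <= M.
Proof.
move=> Cu; have [x ux] := C_torus_min Cu; have [y uy] := C_torus_max Cu.
exists (Num.max (u y) (- u x)) => z; rewrite ler_norml lerNl !le_max uy lerN2 ux.
by rewrite orbT.
Qed.

Lemma C_torus_osc u : C_torus u -> exists M, forall x y, u x - u y <= M.
Proof.
move=> Cu; have [x ux] := C_torus_min Cu; have [y uy] := C_torus_max Cu.
by exists (u y - u x) => z w; rewrite lerB.
Qed.

(** Compactness makes the condition on [h] uniform over the cube; periodicity extends it to all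
    [x]. *)
Lemma C_torus_unif_continuous u (e : R) : C_torus u -> 0 < e ->
  \forall h \near (0 : 'rV[R]_d), forall x, `|u (x + h) - u x| <= e.
Proof.
move=> [cu pu] e0.
pose P h x : Prop := `|u (x + h) - u x| <= e.
have : \forall h \near (0 : 'rV[R]_d), unit_cube `<=` P h.
  have /compact_near_coveringP/(_ _ (nbhs (0 : 'rV[R]_d)) P) := compact_unit_cube.
  apply => x _; rewrite /P.
  have : (fun p : 'rV[R]_d * 'rV[R]_d => u (p.1 + p.2) - u p.1) @
      ((x : 'rV[R]_d), (0 : 'rV[R]_d)) --> u (x + 0) - u x.
    apply: cvgB.
      apply: (@cvg_comp _ _ _ (fun p : 'rV[R]_d * 'rV[R]_d => p.1 + p.2) u _ (nbhs (x + 0))).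
        by apply: cvgD; [exact: cvg_fst|exact: cvg_snd].
      exact: cu.
    apply: (@cvg_comp _ _ _ fst u _ (nbhs x)); [exact: cvg_fst|exact: cu].
  rewrite addr0 subrr => /cvgrPdist_le/(_ e e0).
  by apply: filterS => -[y h] /=; rewrite sub0r normrN.
apply: filterS => h hP x.
have [y /hP /= + yx] := Zperiodic_unit_cube x pu.
have yx0 : u y = u x by have := yx 0; rewrite !add0r.
by rewrite /P yx0 (addrC y) yx (addrC h).
Qed.

End TorusFunctions.

(** * Convolution with the heat kernel *)

Section HeatConvolution.
Context {R : realType} {d : nat} {tau : R}.
Hypothesis tau0 : 0 < tau.
Implicit Types (x y h : 'rV[R]_d) (u v : 'rV[R]_d -> R).

Local Notation mu := (@lebesgue_tuple R d).
Local Notation T := (d.-tuple (measurableTypeR R)).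

Lemma heat_kernel_ge0 x : 0 <= heat_kernel tau x.
Proof. by rewrite mulr_ge0 ?powR_ge0 ?expR_ge0. Qed.

Lemma measurable_heat_kernel y :
  measurable_fun [set: T] (fun z => heat_kernel tau (y - row_of_tuple z)).
Proof.
under eq_fun do rewrite heat_kernel_prod//.
apply: measurable_prod => i _; apply: measurableT_comp; last exact: measurable_tnth.
exact: measurable_normal_pdf.
Qed.

Lemma measurable_heat_integrand u y : continuous u ->
  measurable_fun [set: T]
    (fun z => heat_kernel tau (y - row_of_tuple z) * u (row_of_tuple z)).
Proof.
move=> cu; apply: measurable_funM; first exact: measurable_heat_kernel.
exact: measurable_comp_row_of_tuple.
Qed.

(** [u] is bounded, so a multiple of the kernel, which has mass one, dominates the integrand. *)
Lemma integrable_heat_integrand u y : C_torus u ->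
  mu.-integrable setT
    (EFin \o fun z => heat_kernel tau (y - row_of_tuple z) * u (row_of_tuple z)).
Proof.
move=> Cu; have [M uM] := C_torus_bounded Cu.
apply: (@le_integrable _ _ _ _ _ _ _
  (fun z => (M%:E * (heat_kernel tau (y - row_of_tuple z))%:E)%E)) => //.
- by apply/measurable_EFinP; apply: measurable_heat_integrand; case: Cu.
- move=> z _ /=; rewrite lee_fin mulrC !normrM ler_wpM2r//.
  exact: le_trans (uM _) (ler_norm _).
- apply: integrableZl => //; apply/integrableP; split.
    by apply/measurable_EFinP; exact: measurable_heat_kernel.
  under eq_integral do rewrite gee0_abs ?lee_fin ?heat_kernel_ge0//.
  by rewrite integral_heat_kernel// ltry.
Qed.

Lemma heat_convE u y : C_torus u ->
  ((heat_conv tau u y)%:E =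
   \int[mu]_z (heat_kernel tau (y - row_of_tuple z) * u (row_of_tuple z))%:E)%E.
Proof.
move=> Cu; rewrite fineK//; apply: integrable_fin_num => //.
exact: integrable_heat_integrand.
Qed.

Lemma heat_conv_cst (c : R) y : heat_conv tau (fun=> c) y = c.
Proof.
have iK : mu.-integrable setT
    (EFin \o fun z => heat_kernel tau (y - row_of_tuple z)).
  have := integrable_heat_integrand y (C_torus_cst 1).
  by apply: eq_integrable => // z _ /=; rewrite mulr1.
rewrite /heat_conv RintegralZr// /Rintegral integral_heat_kernel//=.
by rewrite mul1r.
Qed.

Lemma heat_convB u v y : C_torus u -> C_torus v ->
  heat_conv tau (fun x => u x - v x) y = heat_conv tau u y - heat_conv tau v y.
Proof.
move=> Cu Cv; rewrite -RintegralB//; try exact: integrable_heat_integrand.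
by apply: eq_Rintegral => z _; rewrite mulrBr.
Qed.

Lemma heat_convD u v y : C_torus u -> C_torus v ->
  heat_conv tau (fun x => u x + v x) y = heat_conv tau u y + heat_conv tau v y.
Proof.
move=> Cu Cv; rewrite -RintegralD//; try exact: integrable_heat_integrand.
by apply: eq_Rintegral => z _; rewrite mulrDr.
Qed.

Lemma le_heat_conv u v y : C_torus u -> C_torus v -> (forall x, u x <= v x) ->
  heat_conv tau u y <= heat_conv tau v y.
Proof.
move=> Cu Cv uv; apply: le_Rintegral => //; try exact: integrable_heat_integrand.
by move=> z _; rewrite ler_wpM2l ?heat_kernel_ge0.
Qed.

(* Reduced to [u >= 0] by adding a constant, because the change of variables
   is available only for nonnegative functions. *)
Lemma heat_conv_translate u y h : C_torus u ->
  heat_conv tau u (y + h) = heat_conv tau (fun x => u (x + h)) y.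
Proof.
wlog u0 : u / forall x, 0 <= u x => [wlg|] Cu.
  have [M uM] := C_torus_bounded Cu.
  have Cw := C_torusD Cu (C_torus_cst M).
  have : heat_conv tau (fun x => u x + M) (y + h) =
         heat_conv tau (fun x => u (x + h) + M) y.
    by apply: wlg Cw => x; rewrite -lerBlDr sub0r; have /ler_normlP[] := uM x; lra.
  rewrite !heat_convD ?heat_conv_cst//; try exact: C_torus_cst;
    last exact: C_torus_translate.
  exact: addIr.
apply: EFin_inj; rewrite !heat_convE//; last exact: C_torus_translate.
(* Substituting [z + h] for [z] turns the kernel's argument into [(y + h) - (z + h) = y - z]. *)
rewrite -(@ge0_integral_shift_tuple _ _ (h ord0))//; first last.
- by move=> z; rewrite lee_fin mulr_ge0 ?heat_kernel_ge0.
- by apply/measurable_EFinP; apply: measurable_heat_integrand; case: Cu.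
apply: eq_integral => z _.
have -> : row_of_tuple (shift_tuple (h ord0) z) = row_of_tuple z + h.
  by apply/rowP => i; rewrite !mxE tnth_mktuple.
by rewrite opprD addrACA subrr addr0.
Qed.

(** Moving the evaluation point amounts to translating [u], so continuity comes from uniform
    continuity of [u] and monotonicity of the convolution. *)
Lemma continuous_heat_conv u : C_torus u -> continuous (heat_conv tau u).
Proof.
move=> Cu y; apply/(@cvgrPdist_le _ _ _ _ (nbhs_filter (y : 'rV[R]_d))) => e e0.
have yy : {for y, continuous (fun z : 'rV[R]_d => z - y)}.
  by apply: (@continuousB _ _ _ id (fun=> y)); [exact: cvg_id|exact: cst_continuous].
rewrite /prop_for /continuous_at subrr in yy.
move: (yy _ (C_torus_unif_continuous Cu e0)).
apply: (@filterS _ (nbhs (y : 'rV[R]_d)) (nbhs_filter (y : 'rV[R]_d))) => z /= zP.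
rewrite -(subrK y z) (addrC (z - y)) heat_conv_translate//.
set h := z - y in zP *; have Cuh := C_torus_translate h Cu.
have Ce := C_torus_cst (d := d) e.
suff : heat_conv tau u y - e <= heat_conv tau (fun x => u (x + h)) y <=
    heat_conv tau u y + e by rewrite -ler_distl distrC.
rewrite -(heat_conv_cst e y) -heat_convB// -heat_convD//.
apply/andP; split; apply: le_heat_conv => //.
- exact: C_torusB.
- by move=> x; have := zP x; rewrite ler_distl; lra.
- exact: C_torusD.
- by move=> x; have := zP x; rewrite ler_distl; lra.
Qed.

Lemma C_torus_heat_conv u : C_torus u -> C_torus (heat_conv tau u).
Proof.
move=> Cu; split=> [|y k]; first exact: continuous_heat_conv.
rewrite heat_conv_translate//; congr heat_conv; apply/funext => x.
by case: Cu => _ ->.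
Qed.

(** Such [x] are the differences of points of the unit cube. They satisfy [|x|^2 <= d], and the
    constant is the value of the kernel at [|x|^2 = d]. *)
Lemma heat_kernel_lower_bound :
  exists2 c : R, 0 < c & forall x, (forall i, `|x ord0 i| <= 1) ->
    c <= heat_kernel tau (x : 'rV[R]_d).
Proof.
exists ((4 * pi * tau) `^ (- (d%:R / 2)) * expR (- (d%:R / (4 * tau)))).
  by rewrite mulr_gt0 ?expR_gt0// powR_gt0// !mulr_gt0// pi_gt0.
move=> x x1; rewrite ler_wpM2l ?powR_ge0// ler_expR lerN2.
apply: ler_wpM2r; first by rewrite invr_ge0 mulr_ge0 ?ltW.
rewrite /enorm sqr_sqrtr; last by apply: sumr_ge0 => i _; exact: sqr_ge0.
have -> : (d%:R : R) = \sum_(i < d) 1 by rewrite sumr_const card_ord.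
apply: ler_sum => i _.
by rewrite -real_normK ?num_real// expr_le1.
Qed.

(** With [m] the minimum of [u], the functions [g1 = m + M - u] and [g2 = u - m] are nonnegative
    with sum [M]. The contraction amounts to a lower bound [c * M] on the convolution of [g1] at [x]
    plus that of [g2] at [y]. *)
Lemma heat_conv_contraction : exists2 rho : R, 0 < rho < 1 &
  forall u, C_torus u -> forall M, (forall x y, u x - u y <= M) ->
  forall x y, heat_conv tau u x - heat_conv tau u y <= rho * M.
Proof.
have [c0 c00 c0P] := heat_kernel_lower_bound.
(* The cap [1 / 2] keeps [rho = 1 - c] positive. *)
pose c := Num.min c0 (1 / 2).
have c_gt0 : 0 < c by rewrite lt_min c00 divr_gt0.
have c_lt1 : c < 1 by rewrite gt_min; apply/orP; right; lra.
exists (1 - c); first by apply/andP; split; lra.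
move=> u Cu M uM x y.
(* Periodicity brings both points into the cube, where the lower bound on the kernel applies. *)
wlog [xQ yQ] : x y / unit_cube x /\ unit_cube y.
  have [_ Pp] := C_torus_heat_conv Cu => wlg.
  have [x' x'Q xx'] := Zperiodic_unit_cube x Pp.
  have [y' y'Q yy'] := Zperiodic_unit_cube y Pp.
  have := wlg x' y' (conj x'Q y'Q).
  by have := xx' 0; have := yy' 0; rewrite !add0r => -> ->.
have [x0 ux0] := C_torus_min Cu.
pose m := u x0; pose g1 z := m + M - u z; pose g2 z := u z - m.
have Cg1 : C_torus g1 by apply: C_torusB => //; exact: C_torus_cst.
have Cg2 : C_torus g2 by apply: C_torusB => //; exact: C_torus_cst.
have g10 z : 0 <= g1 z by have := uM z x0; rewrite /g1 /m; lra.
have g20 z : 0 <= g2 z by rewrite subr_ge0.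
have M0 : 0 <= M by have := uM 0 0; rewrite subrr.
pose Q : set T := [set z | forall i, `[0, 1]%classic (tnth z i)].
have QE : Q = \bigcap_(i in [set: 'I_d])
    ((fun z : T => tnth z i) @^-1` `[0, 1]%classic).
  by apply/seteqP; split=> [z /= h i _|z /= h i]; [exact: h|exact: h].
have mQ : measurable Q.
  rewrite QE; apply: fin_bigcap_measurable => // i _.
  rewrite -[X in measurable X]setTI.
  by apply: measurable_tnth => //; exact: measurable_itv.
have muQ : mu Q = 1%E.
  rewrite /Q (lebesgue_tuple_box (A := fun=> `[0, 1]%classic)); last first.
    by move=> _; exact: measurable_itv.
  rewrite big1// => i _; rewrite lebesgue_measure_itv/= lte_fin ltr01 oppr0 adde0 //.
(* [g1 + g2 = M] and both kernels are at least [c] on [Q]. *)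
have : c * M <= heat_conv tau g1 x + heat_conv tau g2 y.
  rewrite -lee_fin EFinD !heat_convE// -ge0_integralD//; first last.
  - by apply/measurable_EFinP; apply: measurable_heat_integrand; case: Cg2.
  - by move=> z _; rewrite lee_fin mulr_ge0 ?heat_kernel_ge0.
  - by apply/measurable_EFinP; apply: measurable_heat_integrand; case: Cg1.
  - by move=> z _; rewrite lee_fin mulr_ge0 ?heat_kernel_ge0.
  have -> : (c * M)%:E = (\int[mu]_(z in Q) (c * M)%:E)%E.
    by rewrite integral_cst// muQ mule1.
  rewrite (integral_mkcond Q); apply: ge0_le_integral => //.
  - move=> z _; rewrite patchE; case: ifP => // _.
    by rewrite lee_fin (mulr_ge0 (ltW c_gt0)).
  - by apply/(measurable_restrictT _ mQ); exact: measurable_cst.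
  - apply: emeasurable_funD; apply/measurable_EFinP; apply: measurable_heat_integrand.
      by case: Cg1.
    by case: Cg2.
  - move=> z _; rewrite patchE; case: ifPn => [|_]; last first.
      by rewrite -EFinD lee_fin addr_ge0// mulr_ge0 ?heat_kernel_ge0.
    rewrite inE => zQ; rewrite -EFinD lee_fin.
    have cK w : unit_cube w -> c <= heat_kernel tau (w - row_of_tuple z).
      move=> wQ; apply: (@le_trans _ _ c0); first by rewrite ge_min lexx.
      apply: c0P => i; rewrite !mxE ler_norml.
      have := wQ i; have := zQ i; rewrite /= !in_itv /= => /andP[? ?] /andP[? ?].
      by apply/andP; split; lra.
    have -> : c * M = c * g1 (row_of_tuple z) + c * g2 (row_of_tuple z).
      by rewrite /g1 /g2; ring.
    by apply: lerD; apply: ler_wpM2r; rewrite ?cK.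
(* By linearity the sum of the two convolutions is [M - (heat_conv tau u x - heat_conv tau u y)]. *)
rewrite (heat_convB x (C_torus_cst (m + M)) Cu) (heat_convB y Cu (C_torus_cst m)).
rewrite !heat_conv_cst mulrBl mul1r /m; clear.
move: (c * M) (u x0) (heat_conv tau u x) (heat_conv tau u y) => cM m a b; lra.
Qed.

End HeatConvolution.

(** * The minimization step *)

Lemma continuous_slicel (T U V : topologicalType) (f : T -> U -> V) (y : U) :
  continuous (fun p : T * U => f p.1 p.2) -> continuous (f^~ y).
Proof.
move=> cf x; apply: (@continuous2_cvg _ _ _ _ _ _ id (fun=> y) f x y (cf (x, y))).
  exact: cvg_id.
exact: cst_continuous.
Qed.

Lemma continuous_slicer (T U V : topologicalType) (f : T -> U -> V) (x : T) :
  continuous (fun p : T * U => f p.1 p.2) -> continuous (f x).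
Proof.
move=> cf y; apply: (@continuous2_cvg _ _ _ _ _ _ (fun=> x) id f x y (cf (x, y))).
  exact: cst_continuous.
exact: cvg_id.
Qed.

Section InfConvolution.
Context {R : realType} {d : nat}.
Variables (L : 'rV[R]_d -> 'rV[R]_d -> R) (tau : R).
Hypothesis cL : continuous (fun p : 'rV[R]_d * 'rV[R]_d => L p.1 p.2).
Hypothesis pL : forall q, Zperiodic (fun x => L x q).
Hypothesis sL : superlinear L.
Hypothesis tau0 : 0 < tau.
Implicit Types (x y q : 'rV[R]_d) (w v : 'rV[R]_d -> R).

Definition action w x q : R := tau * L x (- q) + w (x + tau *: q).

(** The minimization half of the operator: at [w = heat_conv tau u] it is convertible to
    [lax_oleinik L tau u v], and later proofs pass from one to the other silently. *)
Definition is_inf_convolution w v :=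
  forall x, is_minimum [set action w x q | q in [set: 'rV[R]_d]] (v x).

Lemma is_inf_convolutionP w v : is_inf_convolution w v <->
  forall x, (exists q, action w x q = v x) /\ (forall q, v x <= action w x q).
Proof.
split=> vP x; have [] := vP x.
  move=> [q _ qx] lb; split; first by exists q.
  by move=> q'; apply: lb; exists q'.
by move=> [q qx] lb; split; [exists q|move=> _ [q' _ <-]].
Qed.

(** Each value is tested against the other problem's minimizer: [v1 x] against the minimizer [q2]
    for [v2 x], and [v2 y] against the minimizer [q1] for [v1 y]. The terms in [L] cancel. *)
Lemma inf_convolution_osc w1 w2 v1 v2 (M : R) :
  is_inf_convolution w1 v1 -> is_inf_convolution w2 v2 ->
  (forall x y, (w1 x - w2 x) - (w1 y - w2 y) <= M) ->
  forall x y, (v1 x - v2 x) - (v1 y - v2 y) <= M.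
Proof.
move=> /is_inf_convolutionP v1P /is_inf_convolutionP v2P wM x y.
have [[q2 q2x] _] := v2P x; have [_ /(_ q2) v1x] := v1P x.
have [[q1 q1y] _] := v1P y; have [_ /(_ q1) v2y] := v2P y.
have := wM (x + tau *: q2) (y + tau *: q1).
rewrite /action in q2x q1y v1x v2y; lra.
Qed.

Lemma ler_enorm q i : `|q ord0 i| <= enorm q.
Proof.
rewrite -sqrtr_sqr ler_wsqrtr// (bigD1 i)//= lerDl.
by apply: sumr_ge0 => j _; exact: sqr_ge0.
Qed.

Lemma enormN q : enorm (- q) = enorm q.
Proof. by congr Num.sqrt; apply: eq_bigr => i _; rewrite mxE sqrrN. Qed.

(** Superlinearity at slope 1: linear growth uniform in [x], to be set against a bounded [w]. *)
Lemma superlinear_ge_enorm :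
  exists2 K : R, 0 <= K & forall x q, K < enorm q -> enorm q <= L x q.
Proof.
have [K [K0 KP]] := sL 1; exists K => // x q Kq.
have := le_trans (KP q Kq) (ereal_inf_lbound _) => /(_ (L x q / enorm q)%:E).
by rewrite lee_fin ler_pdivlMr ?mul1r ?(le_lt_trans K0)//; apply; exists x.
Qed.

Lemma continuous_action w : continuous w ->
  continuous (fun p : 'rV[R]_d * 'rV[R]_d => action w p.1 p.2).
Proof.
move=> cw p.
have c1 : {for p, continuous (fun p : 'rV[R]_d * 'rV[R]_d => p.1)} by exact: cvg_fst.
have c2 : {for p, continuous (fun p : 'rV[R]_d * 'rV[R]_d => - p.2)}.
  apply: (@continuous_comp _ _ _ snd (-%R : 'rV[R]_d -> 'rV[R]_d)).
    exact: cvg_snd.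
  exact: oppr_continuous.
have c3 : {for p, continuous (fun p : 'rV[R]_d * 'rV[R]_d => tau *: p.2)}.
  apply: (@continuous_comp _ _ _ snd (fun q : 'rV[R]_d => tau *: q)).
    exact: cvg_snd.
  exact: scaler_continuous.
have c4 : {for p, continuous (fun p : 'rV[R]_d * 'rV[R]_d => L p.1 (- p.2))}.
  exact: (@continuous2_cvg _ _ _ _ _ _ _ _ L _ _ (@cL (p.1, - p.2)) c1 c2).
have c5 : {for p, continuous (fun p : 'rV[R]_d * 'rV[R]_d => p.1 + tau *: p.2)}.
  exact: cvgD c1 c3.
have c6 := @continuous_comp _ _ _ _ w p c5 (cw _).
have c7 : {for p, continuous (fun p : 'rV[R]_d * 'rV[R]_d => tau * L p.1 (- p.2))}.
  by apply: (@continuousM _ _ (fun=> tau) _ p); [exact: cst_continuous|exact: c4].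

exact: cvgD c7 c6.
Qed.

Definition box (r : R) : set 'rV[R]_d :=
  [set q | forall i, `[- r, r]%classic (q ord0 i)].

Lemma compact_box r : compact (box r).
Proof.
apply: (@rV_compact _ _ (fun=> `[- r, r]%classic)) => _.
exact: segment_compact.
Qed.

Lemma notin_box r q : ~ box r q -> r < enorm q.
Proof.
move=> /existsNP[i] /negP; rewrite in_itv /= -ler_norml -ltNge => /lt_le_trans.
by apply; exact: ler_enorm.
Qed.

Lemma action_coercive w : C_torus w ->
  exists2 r : R, 0 <= r & forall x q, ~ box r q -> action w x 0 <= action w x q.
Proof.
move=> Cw; have [K K0 KP] := superlinear_ge_enorm.
have C0 : C_torus (L^~ 0).
  split; last exact: pL.
  exact: (continuous_slicel cL).
have [A LA] := C_torus_bounded C0; have [B wB] := C_torus_bounded Cw.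
(* [A] bounds [L x 0] and [B] bounds [w]. Outside the box [tau * enorm q > tau * A + 2 * B], so the
   action exceeds [tau * A + B], which bounds the action at 0. *)
exists (Num.max K ((tau * A + 2 * B) / tau)); first by rewrite le_max K0.
move=> x q /notin_box; rewrite gt_max -(enormN q) => /andP[Kq].
rewrite ltr_pdivrMr// => rq; have := KP x _ Kq.
rewrite /action oppr0 scaler0 addr0 => Lq.
have /ler_normlP[_ LAx] := LA x; have /ler_normlP[_ wx] := wB x.
have /ler_normlP[wq _] := wB (x + tau *: q).
have := ler_wpM2l (ltW tau0) Lq; have := ler_wpM2l (ltW tau0) LAx.
rewrite (mulrC _ tau) in rq; lra.
Qed.

(** The box is chosen before [x]: continuity of the minimum relies on one compact set holding
    minimizers for all [x]. Points outside the box lose to 0, which lies inside. *)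
Lemma ex_action_min w : C_torus w -> exists r : R, forall x,
  exists2 q, box r q & forall q', action w x q <= action w x q'.
Proof.
move=> Cw; have [r r0 rP] := action_coercive Cw; exists r => x.
have b0 : box r 0 by move=> i; rewrite /= mxE in_itv /= oppr_le0 r0.
have [||q qb qP] := compact_EVT_min (f := action w x) _ (@compact_box r) _.
- by exists 0.
- apply/continuous_subspaceT/(continuous_slicer (f := action w)).
  by apply: continuous_action; case: Cw.
exists q => [|q']; first exact: set_mem.
have [/mem_set/qP //|/(rP x)] := pselect (box r q').
by apply: le_trans; apply: qP; exact: mem_set.
Qed.

(** Upper semicontinuity follows by keeping the minimizer at [x] fixed; lower semicontinuity follows
    from compactness of the box that holds all minimizers. *)
Lemma continuous_inf_convolution w v : C_torus w -> is_inf_convolution w v ->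
  continuous v.
Proof.
move=> Cw /is_inf_convolutionP vP x.
have ca := continuous_action (proj1 Cw).
have [r rP] := ex_action_min Cw.
apply/(@cvgrPdist_le _ _ _ _ (nbhs_filter (x : 'rV[R]_d))) => e e0.
pose P y q : Prop := v x - e <= action w y q.
have lower : \forall y \near (x : 'rV[R]_d), box r `<=` P y.
  have /compact_near_coveringP/(_ _ (nbhs (x : 'rV[R]_d)) P) := @compact_box r.
  apply => q _; rewrite /P.
  have /cvgrPdist_le/(_ e e0) := ca ((x : 'rV[R]_d), q).
  (* The covering argument pairs [q] first and [y] second, so the two neighbourhoods are swapped. *)
  case=> [[A B] /= [xA qB] AB]; exists (B, A) => // -[q' y] [q'B yA] /=.
  have := AB (y, q') (conj yA q'B); rewrite /= ler_distl => /andP[_].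
  by have [_ /(_ q)] := vP x; lra.
have [[q qx] _] := vP x.
have upper : \forall y \near (x : 'rV[R]_d), action w y q <= v x + e.
  have /cvgrPdist_le/(_ e e0) := @continuous_slicel _ _ _ (action w) q ca x.
  apply: (@filterS _ _ (nbhs_filter (x : 'rV[R]_d))) => y /=.
  by rewrite ler_distl qx; lra.
apply: (@filterS2 _ _ (nbhs_filter (x : 'rV[R]_d)) _ _ _ _ lower upper) => y ly uy.
have [q' q'b q'y] := rP y; have [[q2 q2y] vy] := vP y.
have := ly _ q'b; have := vy q; have := q'y q2; rewrite q2y /P ler_distl => *.
by apply/andP; split; lra.
Qed.

Lemma Zperiodic_inf_convolution w v : Zperiodic w -> is_inf_convolution w v ->
  Zperiodic v.
Proof.
move=> pw /is_inf_convolutionP vP x k.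
have aE q : action w (x + map_mx intr k) q = action w x q.
  by rewrite /action (pL (- q)) addrAC pw.
have [[q1 q1x] v1] := vP x; have [[q2 q2x] v2] := vP (x + map_mx intr k).
apply/eqP; rewrite eq_le -{1}q1x -{1}aE v2 -q2x aE.
exact: v1.
Qed.

Lemma ex_inf_convolution w : C_torus w ->
  exists2 v, C_torus v & is_inf_convolution w v.
Proof.
move=> Cw; have [r rP] := ex_action_min Cw.
have /choice[Q QP] : forall x, exists q, forall q', action w x q <= action w x q'.
  by move=> x; have [q _ qP] := rP x; exists q.
have vP : is_inf_convolution w (fun x => action w x (Q x)).
  by apply/is_inf_convolutionP => x; split; [exists (Q x)|exact: QP].
exists (fun x => action w x (Q x)) => //; split.
  exact: continuous_inf_convolution vP.
by apply: Zperiodic_inf_convolution vP; case: Cw.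
Qed.

End InfConvolution.

(** * Contractions for the oscillation *)

Section Contraction.
Context {R : realType} {d : nat}.
Implicit Types (u v : 'rV[R]_d -> R) (rho M : R).

(** Bounds the oscillation of [u - v], the distance modulo constants, without forming a supremum. *)
Definition osc_le u v M := forall x y, (u x - v x) - (u y - v y) <= M.

Lemma geometric_le0 rho M (a : R) : 0 < rho < 1 ->
  (forall n, a <= rho ^+ n * M) -> a <= 0.
Proof.
move=> /andP[rho0 rho1] aM.
have : (fun n => rho ^+ n * M) @ \oo --> 0 * M.
  by apply: cvgM; [apply: cvg_expr; rewrite ger0_norm// ltW|exact: cvg_cst].
rewrite mul0r => cv0; have := limr_ge (cvgP _ cv0); rewrite (cvg_lim _ cv0)//.
by apply; near=> n; exact: aM.
Unshelve. all: by end_near. Qed.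

(** [a n - D n] is nondecreasing, [a n + D n] is nonincreasing, and every term of the first is below
    every term of the second. The supremum is thus an explicit limit with error [D n]. *)
Lemma telescoping_limit (a D : nat -> R) :
  (forall n, 0 <= D n) -> (forall n, `|a n.+1 - a n| <= D n - D n.+1) ->
  forall n, `|sup (range (fun n => a n - D n)) - a n| <= D n.
Proof.
move=> D0 aD.
have akD n k : `|a (n + k)%N - a n| <= D n - D (n + k)%N.
  elim: k => [|k IH]; first by rewrite addn0 !subrr normr0.
  have := aD (n + k)%N; have := ler_distD (a (n + k)%N) (a (n + k.+1)%N) (a n).
  rewrite -addnS; lra.
have ub m n : a m - D m <= a n + D n.
  have := D0 m; have := D0 n; have [/subnKC mn|/ltnW/subnKC nm] := leqP m n.
    by have := akD m (n - m)%N; rewrite mn ler_distl => /andP[]; lra.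
  by have := akD n (m - n)%N; rewrite nm ler_distl => /andP[]; lra.
move=> n; rewrite ler_distl; apply/andP; split.
  apply: ub_le_sup; last by exists n.
  by exists (a n + D n) => _ [m _ <-].
by apply: ge_sup => [|_ [m _ <-]]; [exists (a 0%N - D 0%N); exists 0%N|].
Qed.

Lemma continuous_uniform_limit (T : topologicalType) (f : nat -> T -> R)
    (g : T -> R) rho M : 0 < rho < 1 ->
  (forall n, continuous (f n)) -> (forall n x, `|g x - f n x| <= rho ^+ n * M) ->
  continuous g.
Proof.
move=> rho01 cf fg x; apply/cvgrPdist_le => e e0.
have [n ne] : exists n, rho ^+ n * M < e / 3.
  apply: contrapT => /forallNP ne; have : e / 3 <= 0.
    by apply: geometric_le0 rho01 _ => n; rewrite leNgt; apply/negP.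
  by rewrite leNgt divr_gt0.
have /cvgrPdist_le/(_ (e / 3)) := cf n x; rewrite divr_gt0// => /(_ isT).
apply: filterS => y; have := fg n x; have := fg n y.
have := ler_distD (f n x) (g x) (g y); have := ler_distD (f n y) (f n x) (g y).
rewrite (distrC (f n y) (g y)); lra.
Qed.

(** Banach's fixed point theorem modulo constants. *)
Lemma ex_osc_fixpoint (G : ('rV[R]_d -> R) -> 'rV[R]_d -> R) rho :
  0 < rho < 1 -> (forall u, C_torus u -> C_torus (G u)) ->
  (forall u v M, C_torus u -> C_torus v -> osc_le u v M ->
    osc_le (G u) (G v) (rho * M)) ->
  exists u c, C_torus u /\ forall x, G u x = u x + c.
Proof.
move=> rho01 CG oG.
(* Subtracting the value at 0 selects a representative modulo constants, so that oscillation bounds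
   become pointwise bounds. *)
pose f n : 'rV[R]_d -> R := iter n (fun u x => G u x - G u 0) (fun=> 0).
have fS n x : f n.+1 x = G (f n) x - G (f n) 0 by [].
have Cf n : C_torus (f n).
  elim: n => [|n Cn]; first exact: C_torus_cst.
  by apply: C_torusB; [exact: CG|exact: C_torus_cst].
have f0 n : f n 0 = 0 by case: n => [//|n]; rewrite fS subrr.
have [M fM] := C_torus_osc (C_torusB (Cf 1%N) (Cf 0%N)).
have fosc n : osc_le (f n.+1) (f n) (rho ^+ n * M).
  elim: n => [|n IH]; first by rewrite expr0 mul1r; exact: fM.
  move=> x y; have := oG _ _ _ (Cf n.+1) (Cf n) IH x y.
  rewrite exprS -mulrA !(fS n.+1) !(fS n); lra.
have [rho0 rho1] := andP rho01.
have M0 : 0 <= M by have := fM 0 0; rewrite subrr.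
(* The tail from [n] on of the geometric series with terms [rho ^+ k * M]. *)
pose D n := rho ^+ n * (M / (1 - rho)).
have D0 n : 0 <= D n by rewrite !mulr_ge0 ?exprn_ge0 ?invr_ge0 ?subr_ge0// ltW.
have DB n : D n - D n.+1 = rho ^+ n * M.
  by rewrite /D exprS; field; rewrite subr_eq0 gt_eqF.
pose u x := sup (range (fun n => f n x - D n)).
have uf n x : `|u x - f n x| <= D n.
  apply: (telescoping_limit (a := f^~ x)) => // k; rewrite DB ler_norml.
  have := fosc k x 0; have := fosc k 0 x; rewrite !f0 => *.
  by apply/andP; split; lra.
have Cu : C_torus u.
  split; last first.
    by move=> x k; rewrite /u; under eq_fun do rewrite (proj2 (Cf _)).
  exact: (continuous_uniform_limit rho01 (fun n => proj1 (Cf n)) uf).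
have uosc n : osc_le u (f n) (2 * D n).
  move=> x y; have := uf n x; have := uf n y.
  by rewrite !ler_norml => /andP[? ?] /andP[? ?]; lra.
exists u, (G u 0 - u 0); split => // x.
(* [G u] and [u] are compared through [f n.+1], which is [G (f n)] up to a constant; each comparison
   costs [2 * D n.+1], hence the bound [4 * D n]. *)
have Gu y z : (G u y - u y) - (G u z - u z) <= 0.
  apply: (@geometric_le0 rho (4 * (M / (1 - rho)))) => // n.
  have := oG _ _ _ Cu (Cf n) (uosc n) y z; have := uosc n.+1 z y.
  have : D n.+1 <= D n by rewrite -subr_ge0 DB mulr_ge0 ?exprn_ge0// ltW.
  have : rho * D n = D n.+1 by rewrite /D exprS mulrA.
  have -> : rho ^+ n * (4 * (M / (1 - rho))) = 4 * D n by rewrite /D; ring.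
  rewrite !fS; lra.
by have := Gu x 0; have := Gu 0 x; lra.
Qed.

End Contraction.

(** * Existence and uniqueness for the cell problem *)

Section CellProblem.
Context {R : realType} {d : nat}.
Variables (L : 'rV[R]_d -> 'rV[R]_d -> R) (tau : R).
Hypothesis cL : continuous (fun p : 'rV[R]_d * 'rV[R]_d => L p.1 p.2).
Hypothesis pL : forall q, Zperiodic (fun x => L x q).
Hypothesis sL : superlinear L.
Hypothesis tau0 : 0 < tau.
Implicit Types (u v : 'rV[R]_d -> R).

(** The convolution contracts and the minimization does not expand. Being stated on the graph, this
    serves both a chosen operator and given solutions. *)
Lemma lax_oleinik_contraction : exists2 rho : R, 0 < rho < 1 &
  forall u1 u2 v1 v2 M, C_torus u1 -> C_torus u2 ->
    lax_oleinik L tau u1 v1 -> lax_oleinik L tau u2 v2 ->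
    osc_le u1 u2 M -> osc_le v1 v2 (rho * M).
Proof.
have [rho rho01 rhoP] := @heat_conv_contraction R d tau tau0.
exists rho => // u1 u2 v1 v2 M Cu1 Cu2 v1P v2P uM.
apply: (inf_convolution_osc v1P v2P) => x y.
have := rhoP _ (C_torusB Cu1 Cu2) M uM x y.
by rewrite (heat_convB tau0 x Cu1 Cu2) (heat_convB tau0 y Cu1 Cu2).
Qed.

Lemma ex_cell_solution : exists alpha u, cell_solution L tau alpha u.
Proof.
have [rho rho01 rhoP] := lax_oleinik_contraction.
(* Choice turns the graph into a total function; outside [C_torus] its value is a dummy. *)
have /choice[G GP] : forall u, exists v, C_torus u ->
    C_torus v /\ lax_oleinik L tau u v.
  move=> u; have [Cu|nCu] := pselect (C_torus u); last by exists u.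
  have [v Cv vP] := ex_inf_convolution cL pL sL tau0 (C_torus_heat_conv tau0 Cu).
  by exists v.
have [u|u v M Cu Cv|u [c [Cu uc]]] := @ex_osc_fixpoint R d G rho rho01.
- by move=> /GP[].
- by apply: rhoP => //; apply GP.
(* [G u = u + c] must read [u - tau * alpha]. *)
exists (- c / tau), u; split => //.
have [_] := GP u Cu; congr (lax_oleinik _ _ _ _); apply/funext => x.
by rewrite uc; field; rewrite gt_eqF.
Qed.

Lemma cell_solution_unique (alpha beta : R) u v :
  cell_solution L tau alpha u -> cell_solution L tau beta v ->
  alpha = beta /\ exists c, forall x, v x = u x + c.
Proof.
move=> [Cu uP] [Cv vP]; have [rho rho01 rhoP] := lax_oleinik_contraction.
have [M uvM] := C_torus_osc (C_torusB Cu Cv).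
(* The operator changes [u] and [v] only by constants, so the oscillation of [u - v] is both
   preserved and contracted. *)
have uv n : osc_le u v (rho ^+ n * M).
  elim: n => [|n IH]; first by rewrite expr0 mul1r; exact: uvM.
  move=> x y; have := rhoP _ _ _ _ _ Cu Cv uP vP IH x y.
  rewrite exprS -mulrA; lra.
have uvc x y : (u x - v x) - (u y - v y) <= 0.
  by apply: (geometric_le0 rho01) => n; exact: uv.
have vE x : v x = u x + (v 0 - u 0) by have := uvc x 0; have := uvc 0 x; lra.
split; last by exists (v 0 - u 0).
have hE x : heat_conv tau v x = heat_conv tau u x + (v 0 - u 0).
  rewrite -[in RHS](heat_conv_cst tau0 (v 0 - u 0) x) -heat_convD//;
    last exact: C_torus_cst.
  by congr heat_conv; apply/funext.
(* The minimum problems at 0 for [u] and [v] now differ by the constant [v 0 - u 0]; testing each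
   against the other's minimizer gives [tau * alpha = tau * beta]. *)
have [[p pu] /(_ _) up] := (is_inf_convolutionP _ _ _ _).1 uP 0.
have [[q qv] vq] := (is_inf_convolutionP _ _ _ _).1 vP 0.
apply: (mulfI (lt0r_neq0 tau0)).
move: (vq p) (up q) pu qv; rewrite /action !hE; clear.
move: (tau * L 0 (- p)) (tau * L 0 (- q)) (heat_conv tau u _) (heat_conv tau u _).
move: (u 0) (v 0) (tau * alpha) (tau * beta) => *; lra.
Qed.

End CellProblem.

Theorem theorem1 (R : realType) (d : nat)
    (L : 'rV[R]_d -> 'rV[R]_d -> R) (tau : R) :
  continuous (fun p : 'rV[R]_d * 'rV[R]_d => L p.1 p.2) ->
  (forall q : 'rV[R]_d, Zperiodic (fun x => L x q)) ->
  (forall x : 'rV[R]_d, convex_function [set: 'rV[R]_d] (L x)) ->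
  superlinear L ->
  0 < tau ->
  (exists! alpha : R, exists u : 'rV[R]_d -> R, cell_solution L tau alpha u) /\
  (forall (alpha : R) (u v : 'rV[R]_d -> R),
     cell_solution L tau alpha u -> cell_solution L tau alpha v ->
     exists c : R, forall x : 'rV[R]_d, v x = u x + c).
Proof.
move=> cL pL _ sL tau0; split.
  have [alpha [u uP]] := ex_cell_solution cL pL sL tau0.
  exists alpha; split; first by exists u.
  by move=> beta [v vP]; have [] := cell_solution_unique tau0 uP vP.
by move=> alpha u v uP vP; have [] := cell_solution_unique tau0 uP vP.
Qed.
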